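(* Let $(\mathbf{C},J,j)$ be an involutive (symmetric) monoidal category, and let $U:{\ast\text{-}\mathbf{Obj}}(\mathbf{C},J,j)\to\mathbf{C}$ be the forgetful functor, regarded as a (symmetric) monoidal functor with trivial structure $U_2=\mathrm{id}_{U\otimes}$, $U_0=\mathrm{id}_I$. Any (symmetric) monoidal section $\ast:\mathbf{C}\to{\ast\text{-}\mathbf{Obj}}(\mathbf{C},J,j)$ of $U$ canonically determines an isomorphism in $\mathbf{I(S)MCat}$ between $(\mathbf{C},J,j)$ and the trivial involutive (symmetric) monoidal category $(\mathbf{C},\mathrm{Id}_{\mathbf{C}},\mathrm{id}_{\mathrm{Id}_{\mathbf{C}}})$. In particular, if such a section of $U$ exists, then the involutive (symmetric) monoidal categories $(\mathbf{C},J,j)$ and $(\mathbf{C},\mathrm{Id}_{\mathbf{C}},\mathrm{id}_{\mathrm{Id}_{\mathbf{C}}})$ are isomorphic.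
   Context: The statement has two versions, one for monoidal and one for symmetric monoidal categories. (Symmetric) monoidal functors $F=(F,F_2,F_0)$ are lax, with $F_2:\otimes'(F\times F)\to F\otimes$ and $F_0:I'\to FI$. An involutive (symmetric) monoidal category $(\mathbf{C},J,j)$ is a (symmetric) monoidal category $\mathbf{C}$, a (symmetric) monoidal endofunctor $J=(J,J_2,J_0):\mathbf{C}\to\mathbf{C}$ and a (symmetric) monoidal natural isomorphism $j:\mathrm{Id}_{\mathbf{C}}\to J^2$ such that $jJ=Jj:J\to J^3$. The trivial one over $\mathbf{C}$ is $(\mathbf{C},\mathrm{Id}_{\mathbf{C}},\mathrm{id}_{\mathrm{Id}_{\mathbf{C}}})$ with identity (symmetric) monoidal structure. An involutive (symmetric) monoidal functor $(F,\nu):(\mathbf{C},J,j)\to(\mathbf{C}',J',j')$ is a (symmetric) monoidal functor $F$ with a (symmetric) monoidal natural transformation $\nu:FJ\to J'F$ such that $(J'\nu)(\nu J)(Fj)=j'F$; composition is $(F',\nu')(F,\nu)=(F'F,(\nu'F)(F'\nu))$ and identities are $(\mathrm{Id}_{\mathbf{C}},\mathrm{id}_J)$. An involutive (symmetric) monoidal natural transformation $\zeta:(F,\nu)\to(G,\chi)$ is a (symmetric) monoidal natural transformation with $\chi(\zeta J)=(J'\zeta)\nu$. These form a $2$-category $\mathbf{I(S)MCat}$. A $\ast$-object in $(\mathbf{C},J,j)$ is a $\mathbf{C}$-morphism $\ast:c\to Jc$ with $(J\ast)\ast=j_c$; a $\ast$-morphism $f:(\ast:c\to Jc)\to(\ast':c'\to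 Jc')$ is a $\mathbf{C}$-morphism $f:c\to c'$ with $\ast'f=(Jf)\ast$. The category ${\ast\text{-}\mathbf{Obj}}(\mathbf{C},J,j)$ of these is (symmetric) monoidal with tensor product of $\ast:c\to Jc$ and $\ast':c'\to Jc'$ given by $(J_2)_{c,c'}\,(\ast\otimes\ast'):c\otimes c'\to J(c\otimes c')$, unit $J_0:I\to JI$, and associator, unitors (and braiding) inherited from $\mathbf{C}$. A (symmetric) monoidal section of $U$ is a (symmetric) monoidal functor $\ast:\mathbf{C}\to{\ast\text{-}\mathbf{Obj}}(\mathbf{C},J,j)$ whose composite $U\,\ast$ is the identity (symmetric) monoidal functor of $\mathbf{C}$. *)

(* Defs.v *)
From Stdlib Require Import ProofIrrelevance.

Set Implicit Arguments.
Unset Strict Implicit.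
Unset Printing Implicit Defensive.

Declare Scope cat_scope.
Open Scope cat_scope.

Record Category := {
  ob :> Type;
  hom : ob -> ob -> Type;
  idm : forall a, hom a a;
  comp : forall a b c, hom b c -> hom a b -> hom a c;
  comp_id_l : forall a b (f : hom a b), comp (idm b) f = f;
  comp_id_r : forall a b (f : hom a b), comp f (idm a) = f;
  comp_assoc : forall a b c d (h : hom c d) (g : hom b c) (f : hom a b),
    comp h (comp g f) = comp (comp h g) f
}.

Arguments hom {_} a b.
Arguments idm {_} a.
Arguments comp {_ a b c} g f.

Notation "g ∘ f" := (comp g f) (at level 40, left associativity) : cat_scope.

Definition is_iso (C : Category) (a b : C) (f : hom a b) : Prop :=
  exists g : hom b a, g ∘ f = idm a /\ f ∘ g = idm b.

Record Functor (C D : Category) := {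
  fob :> C -> D;
  fmap : forall a b, hom a b -> hom (fob a) (fob b);
  fmap_id : forall a, fmap (idm a) = idm (fob a);
  fmap_comp : forall a b c (g : hom b c) (f : hom a b),
    fmap (g ∘ f) = fmap g ∘ fmap f
}.

Arguments fmap {C D} F {a b} f : rename.

Definition functor_id (C : Category) : Functor C C :=
  {| fob := fun a => a;
     fmap := fun a b f => f;
     fmap_id := fun a => eq_refl;
     fmap_comp := fun a b c g f => eq_refl |}.

Definition functor_comp (C D E : Category) (G : Functor D E) (F : Functor C D) :
  Functor C E.
Proof.
  refine {| fob := fun a => G (F a);
            fmap := fun a b f => fmap G (fmap F f) |}.
  - abstract (
      intro a;
      now rewrite !fmap_id).
  - abstract (
      intros a b c g f;
      now rewrite !fmap_comp).
Defined.

Record MonCat := {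
  mc_cat :> Category;
  tens : mc_cat -> mc_cat -> mc_cat;
  tensm : forall a b a' b' : mc_cat,
    hom a a' -> hom b b' -> hom (tens a b) (tens a' b');
  unit_ob : mc_cat;
  alpha : forall a b c, hom (tens (tens a b) c) (tens a (tens b c));
  lam : forall a, hom (tens unit_ob a) a;
  rho : forall a, hom (tens a unit_ob) a;
  tensm_id : forall a b, tensm (idm a) (idm b) = idm (tens a b);
  tensm_comp : forall a a' a'' b b' b'' (g : hom a' a'') (f : hom a a')
    (g' : hom b' b'') (f' : hom b b'),
    tensm (g ∘ f) (g' ∘ f') = tensm g g' ∘ tensm f f';
  alpha_nat : forall a a' b b' c c' (f : hom a a') (g : hom b b') (h : hom c c'),
    alpha a' b' c' ∘ tensm (tensm f g) h = tensm f (tensm g h) ∘ alpha a b c;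
  lam_nat : forall a b (f : hom a b), lam b ∘ tensm (idm unit_ob) f = f ∘ lam a;
  rho_nat : forall a b (f : hom a b), rho b ∘ tensm f (idm unit_ob) = f ∘ rho a;
  alpha_iso : forall a b c, is_iso (alpha a b c);
  lam_iso : forall a, is_iso (lam a);
  rho_iso : forall a, is_iso (rho a);
  triangle : forall a b,
    tensm (idm a) (lam b) ∘ alpha a unit_ob b = tensm (rho a) (idm b);
  pentagon : forall a b c d,
    alpha a b (tens c d) ∘ alpha (tens a b) c d
    = tensm (idm a) (alpha b c d) ∘ (alpha a (tens b c) d ∘ tensm (alpha a b c) (idm d))
}.

Arguments tens {_} a b.
Arguments tensm {_ a b a' b'} f g.
Arguments unit_ob {_}.
Arguments alpha {_} a b c.
Arguments lam {_} a.
Arguments rho {_} a.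

(** [⊗] is the tensor product of objects and [⊠] that of morphisms. *)
Notation "a ⊗ b" := (tens a b) (at level 38, left associativity) : cat_scope.
Notation "f ⊠ g" := (tensm f g) (at level 38, left associativity) : cat_scope.

(** Compatibility of the braiding with the unitors follows from these axioms. *)
Record SymMonCat := {
  smc_mon :> MonCat;
  braid : forall a b : smc_mon, hom (a ⊗ b) (b ⊗ a);
  braid_nat : forall (a a' b b' : smc_mon) (f : hom a a') (g : hom b b'),
    braid a' b' ∘ (f ⊠ g) = (g ⊠ f) ∘ braid a b;
  braid_sym : forall a b, braid b a ∘ braid a b = idm (a ⊗ b);
  hexagon : forall a b c,
    (idm b ⊠ braid a c) ∘ (alpha b a c ∘ (braid a b ⊠ idm c))
    = alpha b c a ∘ (braid a (b ⊗ c) ∘ alpha a b c)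
}.

Arguments braid {_} a b.

(** Lax: [mf2] and [mf0] need not be invertible. *)
Record MonFunctor (C D : MonCat) := {
  mf_fun :> Functor C D;
  mf2 : forall a b : C, hom (mf_fun a ⊗ mf_fun b) (mf_fun (a ⊗ b));
  mf0 : hom unit_ob (mf_fun unit_ob);
  mf2_nat : forall (a a' b b' : C) (f : hom a a') (g : hom b b'),
    mf2 a' b' ∘ (fmap mf_fun f ⊠ fmap mf_fun g) = fmap mf_fun (f ⊠ g) ∘ mf2 a b;
  mf_alpha : forall a b c : C,
    fmap mf_fun (alpha a b c) ∘ (mf2 (a ⊗ b) c ∘ (mf2 a b ⊠ idm (mf_fun c)))
    = mf2 a (b ⊗ c) ∘ ((idm (mf_fun a) ⊠ mf2 b c)
                         ∘ alpha (mf_fun a) (mf_fun b) (mf_fun c));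
  mf_lam : forall a : C,
    fmap mf_fun (lam a) ∘ (mf2 unit_ob a ∘ (mf0 ⊠ idm (mf_fun a))) = lam (mf_fun a);
  mf_rho : forall a : C,
    fmap mf_fun (rho a) ∘ (mf2 a unit_ob ∘ (idm (mf_fun a) ⊠ mf0)) = rho (mf_fun a)
}.

Arguments mf2 {C D} F a b : rename.
Arguments mf0 {C D} F : rename.

Definition is_symmetric (C D : SymMonCat) (F : MonFunctor C D) : Prop :=
  forall a b : C, fmap F (braid a b) ∘ mf2 F a b = mf2 F b a ∘ braid (F a) (F b).

Record SymMonFunctor (C D : SymMonCat) := {
  smf_mon :> MonFunctor C D;
  smf_sym : is_symmetric smf_mon
}.

Lemma comp_shift (C : Category) (a b b' c : C)
    (g : hom b c) (f : hom a b) (g' : hom b' c) (f' : hom a b') :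
  g ∘ f = g' ∘ f' ->
  forall z (x : hom z a), g ∘ (f ∘ x) = g' ∘ (f' ∘ x).
Proof. intros e z x. now rewrite !comp_assoc, e. Qed.

Lemma comp_shift1 (C : Category) (a b c : C)
    (g : hom b c) (f : hom a b) (h : hom a c) :
  g ∘ f = h -> forall z (x : hom z a), g ∘ (f ∘ x) = h ∘ x.
Proof. intros e z x. now rewrite comp_assoc, e. Qed.

Lemma tensm_comp_l (C : MonCat) (a a' a'' b : C) (g : hom a' a'') (f : hom a a') :
  (g ∘ f) ⊠ idm b = (g ⊠ idm b) ∘ (f ⊠ idm b).
Proof. now rewrite <- tensm_comp, comp_id_l. Qed.

Lemma tensm_comp_r (C : MonCat) (a b b' b'' : C) (g : hom b' b'') (f : hom b b') :
  idm a ⊠ (g ∘ f) = (idm a ⊠ g) ∘ (idm a ⊠ f).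
Proof. now rewrite <- tensm_comp, comp_id_l. Qed.

Lemma mf2_nat_l (C D : MonCat) (F : MonFunctor C D) (a a' b : C) (f : hom a a') :
  mf2 F a' b ∘ (fmap F f ⊠ idm (F b)) = fmap F (f ⊠ idm b) ∘ mf2 F a b.
Proof. now rewrite <- mf2_nat, fmap_id. Qed.

Lemma mf2_nat_r (C D : MonCat) (F : MonFunctor C D) (a b b' : C) (g : hom b b') :
  mf2 F a b' ∘ (idm (F a) ⊠ fmap F g) = fmap F (idm a ⊠ g) ∘ mf2 F a b.
Proof. now rewrite <- mf2_nat, fmap_id. Qed.

Definition mf_id (C : MonCat) : MonFunctor C C.
Proof.
  refine {| mf_fun := functor_id C;
            mf2 := fun a b => idm (a ⊗ b);
            mf0 := idm unit_ob |}; intros; cbn.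
  - abstract (now rewrite comp_id_l, comp_id_r).
  - abstract (now rewrite !tensm_id, !comp_id_l, comp_id_r).
  - abstract (now rewrite !tensm_id, !comp_id_r).
  - abstract (now rewrite !tensm_id, !comp_id_r).
Defined.

Definition mf_comp (C D E : MonCat) (G : MonFunctor D E) (F : MonFunctor C D) :
  MonFunctor C E.
Proof.
  refine {| mf_fun := functor_comp G F;
            mf2 := fun a b => fmap G (mf2 F a b) ∘ mf2 G (F a) (F b);
            mf0 := fmap G (mf0 F) ∘ mf0 G |}; intros; cbn.
  - abstract (
      rewrite <- comp_assoc, mf2_nat, !comp_assoc, <- !fmap_comp;
      now rewrite mf2_nat).
  - abstract (
      rewrite tensm_comp_l, tensm_comp_r, <- !comp_assoc;
      rewrite (comp_shift (mf2_nat_l _ _ _)), (comp_shift (mf2_nat_r _ _ _));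
      rewrite <- mf_alpha, !comp_assoc, <- !fmap_comp;
      now rewrite <- (comp_assoc (mf2 F _ _)), <- mf_alpha, !comp_assoc).
  - abstract (
      rewrite tensm_comp_l, <- !comp_assoc;
      rewrite (comp_shift (mf2_nat_l _ _ _)), !comp_assoc, <- !fmap_comp;
      rewrite <- (comp_assoc (fmap F _)), mf_lam, <- comp_assoc;
      apply mf_lam).
  - abstract (
      rewrite tensm_comp_r, <- !comp_assoc;
      rewrite (comp_shift (mf2_nat_r _ _ _)), !comp_assoc, <- !fmap_comp;
      rewrite <- (comp_assoc (fmap F _)), mf_rho, <- comp_assoc;
      apply mf_rho).
Defined.

Lemma mf_id_symmetric (C : SymMonCat) : is_symmetric (mf_id C).
Proof. intros a b; cbn. now rewrite comp_id_l, comp_id_r. Qed.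

Lemma mf_comp_symmetric (C D E : SymMonCat) (G : MonFunctor D E) (F : MonFunctor C D) :
  is_symmetric G -> is_symmetric F -> is_symmetric (mf_comp G F).
Proof.
  intros hG hF a b; cbn.
  now rewrite comp_assoc, <- fmap_comp, hF, fmap_comp, <- !comp_assoc, hG.
Qed.

Definition smf_id (C : SymMonCat) : SymMonFunctor C C :=
  {| smf_mon := mf_id C; smf_sym := @mf_id_symmetric C |}.

Definition smf_comp (C D E : SymMonCat) (G : SymMonFunctor D E) (F : SymMonFunctor C D) :
  SymMonFunctor C E :=
  {| smf_mon := mf_comp G F;
     smf_sym := mf_comp_symmetric (smf_sym G) (smf_sym F) |}.

(** Also used for symmetric monoidal natural transformations: these are the
    monoidal natural transformations between the underlying monoidal functors. *)
Record MonNat (C D : MonCat) (F G : MonFunctor C D) := {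
  nt :> forall a : C, hom (F a) (G a);
  nt_nat : forall (a b : C) (f : hom a b), nt b ∘ fmap F f = fmap G f ∘ nt a;
  nt_tens : forall a b : C, nt (a ⊗ b) ∘ mf2 F a b = mf2 G a b ∘ (nt a ⊠ nt b);
  nt_unit : nt unit_ob ∘ mf0 F = mf0 G
}.

(** The componentwise inverse of a monoidal natural transformation is again one. *)
Definition is_nat_iso (C D : MonCat) (F G : MonFunctor C D) (z : MonNat F G) : Prop :=
  forall a : C, is_iso (z a).

Record IMCat := {
  imc_cat :> MonCat;
  inv : MonFunctor imc_cat imc_cat;
  inv_j : MonNat (mf_id imc_cat) (mf_comp inv inv);
  inv_j_iso : is_nat_iso inv_j;
  inv_j_coh : forall c : imc_cat, inv_j (inv c) = fmap inv (inv_j c)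
}.

Arguments inv {_}.
Arguments inv_j {_}.

Record ISMCat := {
  ismc_cat :> SymMonCat;
  sinv : SymMonFunctor ismc_cat ismc_cat;
  sinv_j : MonNat (smf_id ismc_cat) (smf_comp sinv sinv);
  sinv_j_iso : is_nat_iso sinv_j;
  sinv_j_coh : forall c : ismc_cat, sinv_j (sinv c) = fmap sinv (sinv_j c)
}.

Definition ismc_imc (Q : ISMCat) : IMCat :=
  {| imc_cat := Q;
     inv := sinv Q;
     inv_j := sinv_j Q;
     inv_j_iso := @sinv_j_iso Q;
     inv_j_coh := @sinv_j_coh Q |}.

Definition triv_j (C : MonCat) : MonNat (mf_id C) (mf_comp (mf_id C) (mf_id C)).
Proof.
  refine {| nt := fun a : C => idm a : hom (mf_id C a) (mf_comp (mf_id C) (mf_id C) a) |};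
    intros; cbn.
  - abstract (now rewrite comp_id_l, comp_id_r).
  - abstract (now rewrite tensm_id, !comp_id_l).
  - abstract (now rewrite !comp_id_l).
Defined.

Lemma triv_j_iso (C : MonCat) : is_nat_iso (triv_j C).
Proof. intro a. exists (idm a). split; apply comp_id_l. Qed.

Definition triv_imc (C : MonCat) : IMCat :=
  {| imc_cat := C;
     inv := mf_id C;
     inv_j := triv_j C;
     inv_j_iso := @triv_j_iso C;
     inv_j_coh := fun c => eq_refl |}.

Definition triv_ismc (C : SymMonCat) : ISMCat :=
  {| ismc_cat := C;
     sinv := smf_id C;
     sinv_j := triv_j C;
     sinv_j_iso := @triv_j_iso C;
     sinv_j_coh := fun c => eq_refl |}.

Definition nu_compatible (Q Q' : IMCat) (F : MonFunctor Q Q')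
    (nu : MonNat (mf_comp F inv) (mf_comp inv F)) : Prop :=
  forall c : Q,
    fmap inv (nu c) ∘ (nu (inv c) ∘ fmap F (inv_j c)) = (inv_j (F c) : hom (F c) _).

Record IMFunctor (Q Q' : IMCat) := {
  imf_fun :> MonFunctor Q Q';
  imf_nu : MonNat (mf_comp imf_fun inv) (mf_comp inv imf_fun);
  imf_coh : nu_compatible imf_nu
}.

Arguments imf_nu {Q Q'} F : rename.

Definition imf_id_nu (Q : IMCat) : MonNat (mf_comp (mf_id Q) inv) (mf_comp inv (mf_id Q)).
Proof.
  refine {| nt := fun a : Q =>
                    idm (inv a) : hom (mf_comp (mf_id Q) inv a) (mf_comp inv (mf_id Q) a) |};
    intros; cbn.
  - abstract (now rewrite comp_id_l, comp_id_r).
  - abstract (now rewrite tensm_id, fmap_id, !comp_id_l, !comp_id_r).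
  - abstract (now rewrite fmap_id, !comp_id_l, comp_id_r).
Defined.

Lemma imf_id_coh (Q : IMCat) : nu_compatible (imf_id_nu Q).
Proof. intro c; cbn. now rewrite fmap_id, !comp_id_l. Qed.

Definition imf_id (Q : IMCat) : IMFunctor Q Q :=
  {| imf_fun := mf_id Q; imf_nu := imf_id_nu Q; imf_coh := @imf_id_coh Q |}.

Definition imf_comp_nu (Q Q' Q'' : IMCat) (G : IMFunctor Q' Q'') (F : IMFunctor Q Q') :
  MonNat (mf_comp (mf_comp G F) inv) (mf_comp inv (mf_comp G F)).
Proof.
  refine {| nt := fun a : Q =>
                    imf_nu G (F a) ∘ fmap G (imf_nu F a)
                    : hom (mf_comp (mf_comp G F) inv a) (mf_comp inv (mf_comp G F) a) |};
    intros; cbn.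
  - abstract (
      pose proof (nt_nat (imf_nu F) f) as hF;
      pose proof (nt_nat (imf_nu G) (fmap F f)) as hG;
      cbn in *;
      rewrite <- comp_assoc, <- fmap_comp, hF;
      now rewrite fmap_comp, comp_assoc, hG, comp_assoc).
  - abstract (
      pose proof (nt_tens (imf_nu F) a b) as hF;
      pose proof (nt_tens (imf_nu G) (F a) (F b)) as hG;
      pose proof (nt_nat (imf_nu G) (mf2 F a b)) as hN;
      pose proof (mf2_nat G (imf_nu F a) (imf_nu F b)) as hM;
      cbn in *;
      rewrite tensm_comp, (fmap_comp inv), <- !comp_assoc in *;
      rewrite (comp_assoc (mf2 inv _ _)), (comp_assoc (fmap inv (mf2 G _ _))), <- hG;
      rewrite <- !comp_assoc, hM, (comp_shift (eq_sym hN));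
      f_equal;
      rewrite !comp_assoc, <- !fmap_comp;
      rewrite !comp_assoc in hF;
      now rewrite hF).
  - abstract (
      pose proof (nt_unit (imf_nu F)) as hF;
      pose proof (nt_unit (imf_nu G)) as hG;
      pose proof (nt_nat (imf_nu G) (mf0 F)) as hN;
      cbn in *;
      rewrite (fmap_comp inv), <- !comp_assoc, <- hG, (comp_shift (eq_sym hN));
      f_equal;
      now rewrite !comp_assoc, <- !fmap_comp, <- hF, comp_assoc).
Defined.

Lemma imf_comp_coh (Q Q' Q'' : IMCat) (G : IMFunctor Q' Q'') (F : IMFunctor Q Q') :
  nu_compatible (imf_comp_nu G F).
Proof.
  intro c; cbn.
  pose proof (imf_coh F c) as hF.
  pose proof (imf_coh G (F c)) as hG.
  pose proof (nt_nat (imf_nu G) (imf_nu F c)) as hN.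
  cbn in *.
  rewrite <- hG, <- hF, !fmap_comp, <- !comp_assoc. f_equal.
  now rewrite (comp_shift hN).
Qed.

Definition imf_comp (Q Q' Q'' : IMCat) (G : IMFunctor Q' Q'') (F : IMFunctor Q Q') :
  IMFunctor Q Q'' :=
  {| imf_fun := mf_comp G F;
     imf_nu := imf_comp_nu G F;
     imf_coh := imf_comp_coh G F |}.

(** Isomorphism in the strict sense: equality, not 2-isomorphism, of 1-cells. *)
Definition imf_is_iso (Q Q' : IMCat) (F : IMFunctor Q Q') : Prop :=
  exists G : IMFunctor Q' Q,
    imf_comp G F = imf_id Q /\ imf_comp F G = imf_id Q'.

Definition im_isomorphic (Q Q' : IMCat) : Prop :=
  exists F : IMFunctor Q Q', imf_is_iso F.

Record ISMFunctor (Q Q' : ISMCat) := {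
  ismf_fun :> SymMonFunctor Q Q';
  ismf_nu : MonNat (smf_comp ismf_fun (sinv Q)) (smf_comp (sinv Q') ismf_fun);
  ismf_coh : @nu_compatible (ismc_imc Q) (ismc_imc Q') ismf_fun ismf_nu
}.

Arguments ismf_nu {Q Q'} F : rename.

Definition ismf_imf (Q Q' : ISMCat) (F : ISMFunctor Q Q') :
  IMFunctor (ismc_imc Q) (ismc_imc Q') :=
  @Build_IMFunctor (ismc_imc Q) (ismc_imc Q') F (ismf_nu F) (@ismf_coh _ _ F).

Definition ismf_id (Q : ISMCat) : ISMFunctor Q Q :=
  {| ismf_fun := smf_id Q;
     ismf_nu := imf_id_nu (ismc_imc Q);
     ismf_coh := @imf_id_coh (ismc_imc Q) |}.

Definition ismf_comp (Q Q' Q'' : ISMCat) (G : ISMFunctor Q' Q'') (F : ISMFunctor Q Q') :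
  ISMFunctor Q Q'' :=
  {| ismf_fun := smf_comp G F;
     ismf_nu := imf_comp_nu (ismf_imf G) (ismf_imf F);
     ismf_coh := imf_comp_coh (ismf_imf G) (ismf_imf F) |}.

Definition ismf_is_iso (Q Q' : ISMCat) (F : ISMFunctor Q Q') : Prop :=
  exists G : ISMFunctor Q' Q,
    ismf_comp G F = ismf_id Q /\ ismf_comp F G = ismf_id Q'.

Definition ism_isomorphic (Q Q' : ISMCat) : Prop :=
  exists F : ISMFunctor Q Q', ismf_is_iso F.

Record StarOb (Q : IMCat) := {
  so_ob :> Q;
  so_star : hom so_ob (inv so_ob);
  so_eq : fmap inv so_star ∘ so_star = inv_j so_ob
}.

Arguments so_star {Q} X : rename.

Record StarHom (Q : IMCat) (X Y : StarOb Q) := {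
  sh_hom :> hom (so_ob X) (so_ob Y);
  sh_eq : so_star Y ∘ sh_hom = fmap inv sh_hom ∘ so_star X
}.

Lemma star_hom_ext (Q : IMCat) (X Y : StarOb Q) (f g : StarHom X Y) :
  sh_hom f = sh_hom g -> f = g.
Proof.
  destruct f as [f hf], g as [g hg]; cbn; intros ->.
  f_equal; apply proof_irrelevance.
Qed.

Definition star_id (Q : IMCat) (X : StarOb Q) : StarHom X X.
Proof.
  refine {| sh_hom := idm (so_ob X) |}.
  now rewrite fmap_id, comp_id_l, comp_id_r.
Defined.

Definition star_comp (Q : IMCat) (X Y Z : StarOb Q) (g : StarHom Y Z) (f : StarHom X Y) :
  StarHom X Z.
Proof.
  refine {| sh_hom := sh_hom g ∘ sh_hom f |}.
  now rewrite comp_assoc, sh_eq, <- comp_assoc, sh_eq, fmap_comp, comp_assoc.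
Defined.

Definition star_cat (Q : IMCat) : Category.
Proof.
  refine {| ob := StarOb Q; hom := @StarHom Q; idm := @star_id Q; comp := @star_comp Q |};
    intros; apply star_hom_ext; cbn.
  - abstract (apply comp_id_l).
  - abstract (apply comp_id_r).
  - abstract (apply comp_assoc).
Defined.

Lemma star_iso (Q : IMCat) (X Y : star_cat Q) (f : hom X Y) :
  is_iso (sh_hom f) -> is_iso f.
Proof.
  intros [g [gf fg]].
  assert (e : so_star X ∘ g = fmap inv g ∘ so_star Y).
  { rewrite <- (comp_id_r (so_star Y)), <- fg, (comp_assoc (so_star Y)), sh_eq.
    rewrite !comp_assoc, <- fmap_comp, gf, fmap_id. now rewrite comp_id_l. }
  exists {| sh_hom := g; sh_eq := e |}.
  split; apply star_hom_ext; cbn; assumption.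
Qed.

Definition star_tens (Q : IMCat) (X Y : star_cat Q) : star_cat Q.
Proof.
  refine {| so_ob := so_ob X ⊗ so_ob Y;
            so_star := mf2 inv (so_ob X) (so_ob Y) ∘ (so_star X ⊠ so_star Y) |}.
  pose proof (nt_tens (@inv_j Q) (so_ob X) (so_ob Y)) as h; cbn in h.
  rewrite comp_id_r in h.
  rewrite h, <- !so_eq, tensm_comp, fmap_comp, <- !comp_assoc.
  now rewrite (comp_shift (mf2_nat _ _ _)).
Defined.

Definition star_tensm (Q : IMCat) (X Y X' Y' : star_cat Q) (f : hom X X') (g : hom Y Y') :
  hom (star_tens X Y) (star_tens X' Y').
Proof.
  refine {| sh_hom := sh_hom f ⊠ sh_hom g : hom (star_tens X Y : StarOb Q)
                                                (star_tens X' Y' : StarOb Q) |}; cbn.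
  rewrite <- comp_assoc, <- tensm_comp, !sh_eq, tensm_comp.
  now rewrite !comp_assoc, mf2_nat.
Defined.

Definition star_unit (Q : IMCat) : star_cat Q.
Proof.
  refine {| so_ob := unit_ob; so_star := mf0 (@inv Q) |}.
  pose proof (nt_unit (@inv_j Q)) as h; cbn in h.
  now rewrite comp_id_r in h.
Defined.

Definition star_alpha (Q : IMCat) (X Y Z : star_cat Q) :
  hom (star_tens (star_tens X Y) Z) (star_tens X (star_tens Y Z)).
Proof.
  refine {| sh_hom := alpha (so_ob X) (so_ob Y) (so_ob Z)
              : hom (star_tens (star_tens X Y) Z : StarOb Q)
                    (star_tens X (star_tens Y Z) : StarOb Q) |}; cbn.
  pose proof (mf_alpha (@inv Q) X Y Z) as h.
  assert (eX : so_star X ⊠ (mf2 inv Y Z ∘ (so_star Y ⊠ so_star Z))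
               = (idm (inv X) ⊠ mf2 inv Y Z) ∘ (so_star X ⊠ (so_star Y ⊠ so_star Z)))
    by now rewrite <- tensm_comp, comp_id_l.
  assert (eZ : (mf2 inv X Y ∘ (so_star X ⊠ so_star Y)) ⊠ so_star Z
               = (mf2 inv X Y ⊠ idm (inv Z)) ∘ ((so_star X ⊠ so_star Y) ⊠ so_star Z))
    by now rewrite <- tensm_comp, comp_id_l.
  rewrite eX, eZ, <- !comp_assoc, <- alpha_nat.
  rewrite !comp_assoc in *. now rewrite h.
Defined.

Definition star_lam (Q : IMCat) (X : star_cat Q) : hom (star_tens (star_unit Q) X) X.
Proof.
  refine {| sh_hom := lam (so_ob X) : hom (star_tens (star_unit Q) X : StarOb Q)
                                          (X : StarOb Q) |}; cbn.
  rewrite <- lam_nat, <- mf_lam, <- !comp_assoc, <- tensm_comp.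
  now rewrite comp_id_l, comp_id_r.
Defined.

Definition star_rho (Q : IMCat) (X : star_cat Q) : hom (star_tens X (star_unit Q)) X.
Proof.
  refine {| sh_hom := rho (so_ob X) : hom (star_tens X (star_unit Q) : StarOb Q)
                                          (X : StarOb Q) |}; cbn.
  rewrite <- rho_nat, <- mf_rho, <- !comp_assoc, <- tensm_comp.
  now rewrite comp_id_l, comp_id_r.
Defined.

Definition star_moncat (Q : IMCat) : MonCat.
Proof.
  refine {| mc_cat := star_cat Q;
            tens := @star_tens Q;
            tensm := fun X Y X' Y' => @star_tensm Q X Y X' Y';
            unit_ob := star_unit Q;
            alpha := @star_alpha Q;
            lam := @star_lam Q;
            rho := @star_rho Q |}; intros.
  - abstract (apply star_hom_ext, tensm_id).
  - abstract (apply star_hom_ext, tensm_comp).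
  - abstract (apply star_hom_ext, alpha_nat).
  - abstract (apply star_hom_ext, lam_nat).
  - abstract (apply star_hom_ext, rho_nat).
  - abstract (apply star_iso, alpha_iso).
  - abstract (apply star_iso, lam_iso).
  - abstract (apply star_iso, rho_iso).
  - abstract (apply star_hom_ext, triangle).
  - abstract (apply star_hom_ext, pentagon).
Defined.

Definition star_braid (Q : ISMCat) (X Y : star_moncat (ismc_imc Q)) :
  hom (X ⊗ Y) (Y ⊗ X).
Proof.
  refine {| sh_hom := braid (so_ob X) (so_ob Y)
              : hom (X ⊗ Y : StarOb (ismc_imc Q)) (Y ⊗ X : StarOb (ismc_imc Q)) |}; cbn.
  rewrite comp_assoc, (smf_sym (sinv Q)), <- !comp_assoc.
  now rewrite <- braid_nat.
Defined.

Definition star_symmoncat (Q : ISMCat) : SymMonCat.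
Proof.
  refine {| smc_mon := star_moncat (ismc_imc Q); braid := @star_braid Q |}; intros.
  - abstract (
      apply star_hom_ext; cbn;
      apply (@braid_nat Q)).
  - abstract (
      apply star_hom_ext; cbn;
      apply (@braid_sym Q)).
  - abstract (
      apply star_hom_ext; cbn;
      apply (@hexagon Q)).
Defined.

Definition forget_functor (Q : IMCat) : Functor (star_cat Q) Q :=
  {| fob := fun X : star_cat Q => so_ob X;
     fmap := fun (X Y : star_cat Q) (f : hom X Y) => sh_hom f;
     fmap_id := fun X => eq_refl;
     fmap_comp := fun X Y Z g f => eq_refl |}.

Definition forget (Q : IMCat) : MonFunctor (star_moncat Q) Q.
Proof.
  refine {| mf_fun := forget_functor Q : Functor (star_moncat Q) Q;
            mf2 := fun X Y : star_moncat Q => idm (so_ob X ⊗ so_ob Y)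
              : hom (forget_functor Q X ⊗ forget_functor Q Y) (forget_functor Q (X ⊗ Y));
            mf0 := idm unit_ob : hom unit_ob (forget_functor Q (unit_ob : star_moncat Q)) |};
    intros; cbn.
  - abstract (now rewrite comp_id_l, comp_id_r).
  - abstract (now rewrite !tensm_id, !comp_id_l, comp_id_r).
  - abstract (now rewrite !tensm_id, !comp_id_r).
  - abstract (now rewrite !tensm_id, !comp_id_r).
Defined.

Lemma forget_symmetric (Q : ISMCat) :
  @is_symmetric (star_symmoncat Q) Q (forget (ismc_imc Q)).
Proof. intros X Y; cbn. now rewrite comp_id_l, comp_id_r. Qed.

Definition sforget (Q : ISMCat) : SymMonFunctor (star_symmoncat Q) Q :=
  @Build_SymMonFunctor (star_symmoncat Q) Q (forget (ismc_imc Q)) (@forget_symmetric Q).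

(** Equality of monoidal functors, hence including the structure maps [mf2], [mf0]. *)
Definition is_section (Q : IMCat) (S : MonFunctor Q (star_moncat Q)) : Prop :=
  mf_comp (forget Q) S = mf_id Q.

Definition is_sym_section (Q : ISMCat) (S : SymMonFunctor Q (star_symmoncat Q)) : Prop :=
  smf_comp (sforget Q) S = smf_id Q.

(* Main.v *)
(** If [U ∘ S] is the identity, the structure maps of the ∗-objects [S c] are the
    components [s c : c → J c] of a monoidal natural transformation [Id → J] with
    [J s ∘ s = j], so [(Id, s)] is an involutive functor from the trivial
    involution to [J].  Every [s c] is invertible: [J (s c)] is split epi since
    [J (s c) ∘ s c = j c], and split mono since [J J (s c) ∘ J (s c) = J (j c)]. *)

From Stdlib Require Import ProofIrrelevance FunctionalExtensionality IndefiniteDescription.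
Require Import Defs.

Set Implicit Arguments.
Unset Strict Implicit.
Unset Printing Implicit Defensive.

Lemma mon_nat_ext (C D : MonCat) (F G : MonFunctor C D) (z w : MonNat F G) :
  (forall a, z a = w a) -> z = w.
Proof.
  destruct z as [z z1 z2 z3], w as [w w1 w2 w3]; cbn; intro e.
  apply functional_extensionality_dep in e. subst w.
  f_equal; apply proof_irrelevance.
Qed.

(** The data are spelled out because the components of the two [imf_nu] are only
    comparable when the underlying functors agree up to conversion. *)
Lemma im_functor_ext (Q Q' : IMCat) (fo : Q -> Q')
    (fm : forall a b, hom a b -> hom (fo a) (fo b)) fid fid' fcomp fcomp'
    (F := @Build_Functor Q Q' fo fm fid fcomp)
    (F' := @Build_Functor Q Q' fo fm fid' fcomp')
    m2 m2' m0 m0' n n' al al' la la' rh rh'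
    (M := @Build_MonFunctor Q Q' F m2 m0 n al la rh)
    (M' := @Build_MonFunctor Q Q' F' m2' m0' n' al' la' rh')
    (nu : MonNat (mf_comp M inv) (mf_comp inv M))
    (nu' : MonNat (mf_comp M' inv) (mf_comp inv M'))
    (h : nu_compatible nu) (h' : nu_compatible nu') :
  (forall a b, m2 a b = m2' a b) -> m0 = m0' -> (forall a, nu a = nu' a) ->
  Build_IMFunctor h = Build_IMFunctor h'.
Proof.
  intros e2 e0 e.
  assert (e2' : m2 = m2')
    by (do 2 (apply functional_extensionality_dep; intro); apply e2).
  clear e2. subst F F'.
  (* The order follows the type dependencies: the functor laws, then the structure maps, then the
     monoidal laws that mention both, and only then do the two transformations have a common
     type. *)
  destruct (proof_irrelevance _ fid fid'), (proof_irrelevance _ fcomp fcomp').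
  destruct e0, e2'. subst M M'.
  destruct (proof_irrelevance _ n n'), (proof_irrelevance _ al al'),
    (proof_irrelevance _ la la'), (proof_irrelevance _ rh rh').
  destruct (mon_nat_ext e).
  f_equal; apply proof_irrelevance.
Qed.

(** Symmetry is a proposition, so the underlying involutive monoidal functor carries all the data.
    Equations between symmetric 1-cells thus reduce to the monoidal case. *)
Lemma ism_functor_ext (Q Q' : ISMCat) (F G : ISMFunctor Q Q') :
  ismf_imf F = ismf_imf G -> F = G.
Proof.
  pose (mk := fun (X : IMFunctor (ismc_imc Q) (ismc_imc Q'))
                  (s : @is_symmetric Q Q' (imf_fun X)) =>
                @Build_ISMFunctor Q Q' (Build_SymMonFunctor s) (imf_nu X) (@imf_coh _ _ X)).
  assert (eta : forall H : ISMFunctor Q Q', H = mk (ismf_imf H) (smf_sym (ismf_fun H)))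
    by now intros [[M s] nu h].
  (* Once [F] and [G] are values of [mk], its arguments can be generalized to variables and [e]
     substituted. *)
  intro e. rewrite (eta F), (eta G). revert e.
  generalize (smf_sym (ismf_fun F) : is_symmetric (imf_fun (ismf_imf F))).
  generalize (smf_sym (ismf_fun G) : is_symmetric (imf_fun (ismf_imf G))).
  generalize (ismf_imf F), (ismf_imf G).
  intros X Y s s' e. subst Y. now destruct (proof_irrelevance _ s s').
Qed.

(** Naturality and the two monoidal axioms say precisely that [fmap S f], [mf2 S a b] and [mf0 S]
    are ∗-morphisms. *)
Definition star_nat (Q : IMCat) (C : MonCat) (S : MonFunctor C (star_moncat Q)) :
  MonNat (mf_comp (forget Q) S) (mf_comp inv (mf_comp (forget Q) S)).
Proof.
  refine {| nt := fun c : C => so_star (S c)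
              : hom (mf_comp (forget Q) S c) (mf_comp inv (mf_comp (forget Q) S) c) |};
    intros; cbn.
  - exact (sh_eq (fmap S f)).
  - rewrite !comp_id_r, <- comp_assoc. exact (sh_eq (mf2 S a b)).
  - rewrite !comp_id_r. exact (sh_eq (mf0 S)).
Defined.

(** The last clause compares [s c] with [so_star (S c)] through a sigma type, since
    [so_ob (S c)] and [c] are only propositionally equal. *)
Lemma section_star_nat (Q : IMCat) (S : MonFunctor Q (star_moncat Q)) :
  is_section S ->
  exists s : MonNat (mf_id Q) (mf_comp inv (mf_id Q)),
    (forall c : Q, fmap inv (s c) ∘ s c = inv_j c) /\
    (forall c : Q, existT (fun x : Q => hom x (inv x)) c (s c)
                   = existT (fun x : Q => hom x (inv x)) (so_ob (S c)) (so_star (S c))).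
Proof.
  intro e.
  (* Quantifying over the transformation makes the claim a property of the composite functor, so [e]
     can be rewritten in it; the terms [so_ob (S c)] are left as they are. *)
  assert (p : exists s : MonNat (mf_comp (forget Q) S) (mf_comp inv (mf_comp (forget Q) S)),
    (forall c : Q, fmap inv (s c) ∘ s c = inv_j (mf_comp (forget Q) S c)) /\
    (forall c : Q, existT (fun x : Q => hom x (inv x)) (mf_comp (forget Q) S c) (s c)
                   = existT (fun x : Q => hom x (inv x)) (so_ob (S c)) (so_star (S c)))).
  { exists (star_nat S). split; intro c; [exact (so_eq (S c)) | reflexivity]. }
  unfold is_section in e. rewrite e in p. exact p.
Qed.

Lemma is_iso_of_involution (Q : IMCat) (c : Q) (s : hom c (inv c)) :
  fmap inv s ∘ s = inv_j c -> is_iso s.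
Proof.
  intro e.
  destruct (inv_j_iso c) as [k [kj jk]], (inv_j_iso (inv c)) as [l [lj jl]].
  cbn in *.
  (* Applying [J] to [e] gives [J (J s) ∘ J s = J (j c) = j (J c)], which [l] inverts. *)
  assert (mono : (l ∘ fmap inv (fmap inv s)) ∘ fmap inv s = idm _).
  { rewrite <- comp_assoc, <- fmap_comp, e, <- lj.
    apply f_equal. symmetry. apply inv_j_coh. }
  exists (k ∘ fmap inv s). split.
  - now rewrite <- comp_assoc, e.
  - rewrite <- (comp_id_l (s ∘ _)), <- mono at 1. rewrite <- comp_assoc.
    rewrite (comp_assoc (fmap inv s) s), e, (comp_assoc _ k), jk, comp_id_l.
    exact mono.
Qed.

Lemma is_iso_mono (C : Category) (a b c : C) (f : hom b c) (g h : hom a b) :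
  is_iso f -> f ∘ g = f ∘ h -> g = h.
Proof.
  intros [k [kf fk]] e.
  now rewrite <- (comp_id_l g), <- (comp_id_l h), <- kf, <- !comp_assoc, e.
Qed.

Lemma section_triv_functor (Q : IMCat) (S : MonFunctor Q (star_moncat Q)) :
  is_section S ->
  exists (nu : MonNat (mf_comp (mf_id Q) (@inv (triv_imc Q))) (mf_comp (@inv Q) (mf_id Q)))
         (h : @nu_compatible (triv_imc Q) Q (mf_id Q) nu),
    forall c : Q, nu (so_ob (S c)) = so_star (S c).
Proof.
  intros [s [hj hs]]%section_star_nat.
  unshelve eexists; [| unshelve eexists].
  - refine {| nt := fun c : Q => s c : hom (mf_comp (mf_id Q) (@inv (triv_imc Q)) c)
                                            (mf_comp (@inv Q) (mf_id Q) c) |}.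
    + exact (nt_nat s).
    + intros a b; cbn. rewrite (comp_id_l (idm _)). exact (nt_tens s a b).
    + cbn. rewrite (comp_id_l (idm _)). exact (nt_unit s).
  - intro c; cbn. rewrite comp_id_r. apply hj.
  - intro c; cbn.
    set (t := fun x : Q => s x : hom x (inv x)).
    change (projT2 (existT (fun x : Q => hom x (inv x)) (so_ob (S c)) (t (so_ob (S c))))
            = so_star (S c)).
    (* Replacing the right-hand pair by a variable [p] lets the sigma-type equation be eliminated
       directly, with no appeal to uniqueness of identity proofs. *)
    assert (k : forall p : {x : Q & hom x (inv x)},
               existT _ c (t c) = p -> t (projT1 p) = projT2 p)
      by now intros p <-.
    exact (k _ (hs c)).
Qed.

(** The inverse 1-cell is again the identity functor, with the componentwise inverses of [nu]; each
    law for them follows by cancelling an invertible component. *)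
Lemma triv_functor_inverse (Q : IMCat)
    (nu : MonNat (mf_comp (mf_id Q) (@inv (triv_imc Q))) (mf_comp (@inv Q) (mf_id Q)))
    (h : @nu_compatible (triv_imc Q) Q (mf_id Q) nu)
    (F := @Build_IMFunctor (triv_imc Q) Q (mf_id Q) nu h) :
  exists (mu : MonNat (mf_comp (mf_id Q) (@inv Q)) (mf_comp (@inv (triv_imc Q)) (mf_id Q)))
         (k : @nu_compatible Q (triv_imc Q) (mf_id Q) mu)
         (G := @Build_IMFunctor Q (triv_imc Q) (mf_id Q) mu k),
    imf_comp G F = imf_id (triv_imc Q) /\ imf_comp F G = imf_id Q.
Proof.
  set (s := fun c : Q => nu c : hom c (inv c)).
  assert (hj : forall c, fmap inv (s c) ∘ s c = (inv_j c : hom c (inv (inv c)))).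
  { intro c. pose proof (h c) as e. cbn in e. rewrite comp_id_r in e. exact e. }
  assert (s_iso : forall c, is_iso (s c))
    by (intro c; apply is_iso_of_involution, hj).
  (* Invertibility is a mere existence statement, so description is used to obtain the inverses as a
     family. *)
  pose (t := fun c => proj1_sig (constructive_indefinite_description _ (s_iso c))).
  assert (ts : forall c, t c ∘ s c = idm c)
    by (intro c; apply (proj2_sig (constructive_indefinite_description _ (s_iso c)))).
  assert (st : forall c, s c ∘ t c = idm (inv c))
    by (intro c; apply (proj2_sig (constructive_indefinite_description _ (s_iso c)))).
  assert (s_nat : forall (a b : Q) (f : hom a b), s b ∘ f = fmap inv f ∘ s a)
    by exact (nt_nat nu).
  assert (s_tens : forall a b : Q, s (a ⊗ b) = mf2 inv a b ∘ (s a ⊠ s b)).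
  { intros a b. pose proof (nt_tens nu a b) as e. cbn in e.
    rewrite fmap_id, !comp_id_r, comp_id_l in e. exact e. }
  assert (s_unit : s unit_ob = mf0 inv).
  { pose proof (nt_unit nu) as e. cbn in e.
    rewrite fmap_id, !comp_id_r, comp_id_l in e. exact e. }
  clearbody t.
  unshelve eexists; [| unshelve eexists].
  - refine {| nt := fun c : Q => t c : hom (mf_comp (mf_id Q) (@inv Q) c)
                                           (mf_comp (@inv (triv_imc Q)) (mf_id Q) c) |}.
    + intros a b f; cbn. apply (is_iso_mono (s_iso b)).
      now rewrite !comp_assoc, st, s_nat, comp_id_l, <- comp_assoc, st, comp_id_r.
    + intros a b; cbn. apply (is_iso_mono (s_iso (a ⊗ b))).
      rewrite !comp_id_l, !comp_id_r, !comp_assoc, st, comp_id_l.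
      now rewrite s_tens, <- comp_assoc, <- tensm_comp, !st, tensm_id, comp_id_r.
    + cbn. rewrite !comp_id_r, <- s_unit. apply ts.
  - intro c; cbn. rewrite <- hj, (comp_assoc _ (fmap inv _)).
    (* This is naturality of [s] at its own component [s c], conjugated by inverses; it turns the
       coherence condition into [t c ∘ s c ∘ t c ∘ s c = idm c]. *)
    assert (e : t (inv c) ∘ fmap inv (s c) = s c ∘ t c).
    { apply (is_iso_mono (s_iso (inv c))).
      now rewrite !comp_assoc, st, comp_id_l, s_nat, <- comp_assoc, st, comp_id_r. }
    now rewrite e, st, comp_id_l, ts.
  - split; apply im_functor_ext; cbn; intros;
      rewrite ?fmap_id, ?comp_id_l; trivial.
Qed.

Theorem theorem3p17 :
  (forall Q : IMCat,
     (forall S : MonFunctor Q (star_moncat Q), is_section S ->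
        exists (nu : MonNat (mf_comp (mf_id Q) (@inv (triv_imc Q)))
                            (mf_comp (@inv Q) (mf_id Q)))
               (h : @nu_compatible (triv_imc Q) Q (mf_id Q) nu),
          (forall c : Q, nu (so_ob (S c)) = so_star (S c)) /\
          imf_is_iso (@Build_IMFunctor (triv_imc Q) Q (mf_id Q) nu h)) /\
     ((exists S : MonFunctor Q (star_moncat Q), is_section S) ->
        im_isomorphic Q (triv_imc Q)))
  /\
  (forall Q : ISMCat,
     (forall S : SymMonFunctor Q (star_symmoncat Q), is_sym_section S ->
        exists (nu : MonNat (smf_comp (smf_id Q) (sinv (triv_ismc Q)))
                            (smf_comp (sinv Q) (smf_id Q)))
               (h : @nu_compatible (ismc_imc (triv_ismc Q)) (ismc_imc Q) (smf_id Q) nu),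
          (forall c : Q, nu (so_ob (Q := ismc_imc Q) (S c))
                         = so_star (Q := ismc_imc Q) (S c)) /\
          ismf_is_iso (@Build_ISMFunctor (triv_ismc Q) Q (smf_id Q) nu h)) /\
     ((exists S : SymMonFunctor Q (star_symmoncat Q), is_sym_section S) ->
        ism_isomorphic Q (triv_ismc Q))).
Proof.
  split; intro Q.
  - assert (P : forall S : MonFunctor Q (star_moncat Q), is_section S ->
      exists (nu : MonNat (mf_comp (mf_id Q) (@inv (triv_imc Q)))
                          (mf_comp (@inv Q) (mf_id Q)))
             (h : @nu_compatible (triv_imc Q) Q (mf_id Q) nu),
        (forall c : Q, nu (so_ob (S c)) = so_star (S c)) /\
        imf_is_iso (@Build_IMFunctor (triv_imc Q) Q (mf_id Q) nu h)).
    { intros S hS.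
      destruct (section_triv_functor hS) as [nu [h hs]].
      destruct (triv_functor_inverse h) as [mu [k e]].
      exists nu, h. split; [exact hs | eexists; exact e]. }
    split; [exact P |].
    (* The constructed 1-cell starts at the trivial involution, so its inverse [G] is the
       isomorphism in the required direction. *)
    intros [S hS]. destruct (P S hS) as [nu [h [_ [G [e1 e2]]]]].
    exists G. eexists. split; [exact e2 | exact e1].
  - assert (P : forall S : SymMonFunctor Q (star_symmoncat Q), is_sym_section S ->
      exists (nu : MonNat (smf_comp (smf_id Q) (sinv (triv_ismc Q)))
                          (smf_comp (sinv Q) (smf_id Q)))
             (h : @nu_compatible (ismc_imc (triv_ismc Q)) (ismc_imc Q) (smf_id Q) nu),
        (forall c : Q, nu (so_ob (Q := ismc_imc Q) (S c))
                       = so_star (Q := ismc_imc Q) (S c)) /\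
        ismf_is_iso (@Build_ISMFunctor (triv_ismc Q) Q (smf_id Q) nu h)).
    { intros S hS.
      assert (hS' : @is_section (ismc_imc Q) (smf_mon S))
        by exact (f_equal (@smf_mon Q Q) hS).
      destruct (section_triv_functor hS') as [nu [h hs]].
      destruct (triv_functor_inverse h) as [mu [k [e1 e2]]].
      (* Symmetric monoidal transformations carry no further condition, so [nu] and [mu] from the
         monoidal case serve unchanged. *)
      exists nu, h. split; [exact hs |].
      exists (@Build_ISMFunctor Q (triv_ismc Q) (smf_id Q) mu k).
      split; apply ism_functor_ext; [exact e1 | exact e2]. }
    split; [exact P |].
    intros [S hS]. destruct (P S hS) as [nu [h [_ [G [e1 e2]]]]].
    exists G. eexists. split; [exact e2 | exact e1].
Qed.
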